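(* Let $n\ge2$. The monoid $STVB_n$ has a presentation with generators $\sigma_1^{\pm1},\tau_1,\gamma_1,v_1,\dots,v_{n-1}$ and the following defining relations (a relation is included exactly when all generators occurring in it exist for the given $n$): $$v_i^2=e\ (1\le i\le n-1),\qquad v_iv_j=v_jv_i\ (|i-j|>1),\qquad v_iv_{i+1}v_i=v_{i+1}v_iv_{i+1}\ (1\le i\le n-2);$$ $$\sigma_1(v_2v_3v_1v_2\sigma_1v_2v_1v_3v_2)=(v_2v_3v_1v_2\sigma_1v_2v_1v_3v_2)\sigma_1;$$ $$(v_1\sigma_1v_1)(v_2\sigma_1v_2)(v_1\sigma_1v_1)=(v_2\sigma_1v_2)(v_1\sigma_1v_1)(v_2\sigma_1v_2);$$ $$\sigma_1v_j=v_j\sigma_1\ (3\le j\le n-1);\qquad \gamma_1^2=e;\qquad \gamma_1v_j=v_j\gamma_1\ (2\le j\le n-1);$$ $$\gamma_1v_1\gamma_1v_1=v_1\gamma_1v_1\gamma_1;\qquad \gamma_1v_1v_2\sigma_1v_2v_1=v_1v_2\sigma_1v_2v_1\gamma_1;\qquad \gamma_1v_1\gamma_1\sigma_1\gamma_1v_1\gamma_1=\sigma_1;$$ $$\sigma_1\sigma_1^{-1}=\sigma_1^{-1}\sigma_1=e;\qquad \sigma_1\tau_1=\tau_1\sigma_1;\qquad \tau_1v_i=v_i\tau_1\ (3\le i\le n-1);$$ $$\tau_1(v_1v_2\sigma_1v_2v_1)\sigma_1=(v_1v_2\sigma_1v_2v_1)\sigma_1(v_1v_2\tau_1v_2v_1);$$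 $$\tau_1(v_2v_3v_1v_2\sigma_1v_2v_1v_3v_2)=(v_2v_3v_1v_2\sigma_1v_2v_1v_3v_2)\tau_1;$$ $$\tau_1(v_2v_3v_1v_2\tau_1v_2v_1v_3v_2)=(v_2v_3v_1v_2\tau_1v_2v_1v_3v_2)\tau_1;$$ $$\gamma_1v_1v_2\tau_1v_2v_1=v_1v_2\tau_1v_2v_1\gamma_1;\qquad \gamma_1v_1\gamma_1\tau_1\gamma_1v_1\gamma_1=\tau_1.$$ Here the generators are the elements of $STVB_n$ with the same names.
   Context: The monoid $STVB_n$ of singular twisted virtual braids on $n$ strands is generated by $\sigma_i^{\pm1},v_i,\tau_i$ $(1\le i\le n-1)$ and $\gamma_i$ $(1\le i\le n)$, with the following relations (for all meaningful indices; $e$ is the identity): $\sigma_i\sigma_i^{-1}=\sigma_i^{-1}\sigma_i=e$, $v_i^2=e$, $\gamma_i^2=e$; for $|i-j|>1$: $\sigma_i\sigma_j=\sigma_j\sigma_i$, $v_iv_j=v_jv_i$, $\tau_i\tau_j=\tau_j\tau_i$, $\sigma_iv_j=v_j\sigma_i$, $\sigma_i\tau_j=\tau_j\sigma_i$, $\tau_iv_j=v_j\tau_i$; $\gamma_i\gamma_j=\gamma_j\gamma_i$ for all $i,j$; $\gamma_j$ commutes with $\sigma_i,v_i,\tau_i$ for $j\ne i,i+1$; $\sigma_i\sigma_{i+1}\sigma_i=\sigma_{i+1}\sigma_i\sigma_{i+1}$; $v_iv_{i+1}v_i=v_{i+1}v_iv_{i+1}$; $v_i\sigma_{i+1}v_i=v_{i+1}\sigma_iv_{i+1}$;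 $v_i\tau_{i+1}v_i=v_{i+1}\tau_iv_{i+1}$; $\sigma_i\tau_i=\tau_i\sigma_i$; $\sigma_i\sigma_{i+1}\tau_i=\tau_{i+1}\sigma_i\sigma_{i+1}$; $\gamma_{i+1}v_i=v_i\gamma_i$; $v_i\sigma_iv_i=\gamma_{i+1}\gamma_i\sigma_i\gamma_i\gamma_{i+1}$; $v_i\tau_iv_i=\gamma_{i+1}\gamma_i\tau_i\gamma_i\gamma_{i+1}$. The remaining generators are expressed through the reduced ones by $\sigma_i=(v_{i-1}\cdots v_1)(v_i\cdots v_2)\sigma_1(v_2\cdots v_i)(v_1\cdots v_{i-1})$ and $\tau_i=(v_{i-1}\cdots v_1)(v_i\cdots v_2)\tau_1(v_2\cdots v_i)(v_1\cdots v_{i-1})$ for $2\le i\le n-1$, and $\gamma_i=(v_{i-1}\cdots v_1)\gamma_1(v_1\cdots v_{i-1})$ for $2\le i\le n$. *)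

(* Defs.v *)
From HB Require Import structures.
From mathcomp Require Import all_boot.
From mathcomp Require Import boolp.

Set Implicit Arguments.
Unset Strict Implicit.
Unset Printing Implicit Defensive.

Local Open Scope quotient_scope.

(* Monoid presentations: words over an alphabet A are sequences, and a set of *)
(* relations u = w is a binary relation on words.                             *)

Inductive moncong (A : Type) (R : seq A -> seq A -> Prop) :
    seq A -> seq A -> Prop :=
  | moncong_rel u w : R u w -> moncong R u w
  | moncong_refl u : moncong R u u
  | moncong_sym u w : moncong R u w -> moncong R w u
  | moncong_trans u w t : moncong R u w -> moncong R w t -> moncong R u t
  | moncong_cat u u' w w' :
      moncong R u u' -> moncong R w w' -> moncong R (u ++ w) (u' ++ w').

Section PresentedMonoid.
Variables (A : Type) (R : seq A -> seq A -> Prop).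

Definition moncongb : rel {classic seq A} := fun u w => `[< moncong R u w >].

Lemma moncongb_refl : reflexive moncongb.
Proof. by move=> u; apply/asboolP/moncong_refl. Qed.

Lemma moncongb_sym : symmetric moncongb.
Proof.
by move=> u w; apply/asboolP/asboolP => /moncong_sym.
Qed.

Lemma moncongb_trans : transitive moncongb.
Proof.
move=> w u t /asboolP uw /asboolP wt; apply/asboolP.
exact: moncong_trans uw wt.
Qed.

Canonical moncong_equiv :=
  EquivRel moncongb moncongb_refl moncongb_sym moncongb_trans.

Definition pmonoid : Type := {eq_quot moncong_equiv}.
HB.instance Definition _ := Choice.on pmonoid.

Definition pclass (u : seq A) : pmonoid :=
  \pi_({eq_quot moncong_equiv}) (u : {classic seq A}).
Definition prepr (x : pmonoid) : seq A :=
  repr (x : {eq_quot moncong_equiv}).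

Lemma preprK : cancel prepr pclass.
Proof. by move=> x; apply: reprK. Qed.

Lemma pclassP (u w : seq A) : pclass u = pclass w <-> moncong R u w.
Proof.
split=> [/eqmodP /asboolP //|uw].
by apply/eqmodP; apply/asboolP.
Qed.

Definition pmul (x y : pmonoid) : pmonoid := pclass (prepr x ++ prepr y).

Lemma pclass_cat u w : pclass (u ++ w) = pmul (pclass u) (pclass w).
Proof.
by apply/pclassP/moncong_cat; apply/pclassP; rewrite preprK.
Qed.

Fact pmulA : associative pmul.
Proof.
move=> x y z; rewrite -[x]preprK -[y]preprK -[z]preprK.
by rewrite -!pclass_cat catA.
Qed.

Fact pmul1 : left_id (pclass [::]) pmul.
Proof. by move=> x; rewrite -[x]preprK -pclass_cat. Qed.

Fact p1mul : right_id (pclass [::]) pmul.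
Proof. by move=> x; rewrite -[x]preprK -pclass_cat cats0. Qed.

HB.instance Definition _ := isMonoid.Build pmonoid pmulA pmul1 p1mul.

Definition pgen (a : A) : pmonoid := pclass [:: a].

End PresentedMonoid.

Definition word_val (A : Type) (M : monoidType) (f : A -> M) (u : seq A) : M :=
  \big[*%g/1%g]_(a <- u) f a.

(* M is presented by the generators f a (a : A) and the relations R: the      *)
(* canonical morphism from the free monoid on A to M is onto, and its kernel  *)
(* is the congruence generated by R.                                          *)
Definition presents (A : Type) (R : seq A -> seq A -> Prop) (M : monoidType)
    (f : A -> M) : Prop :=
  (forall x : M, exists u : seq A, word_val f u = x) /\
  (forall u w : seq A, word_val f u = word_val f w <-> moncong R u w).

Lemma word_val_pgen (A : Type) (R : seq A -> seq A -> Prop) (u : seq A) :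
  word_val (pgen R) u = pclass R u.
Proof.
rewrite /word_val; elim: u => [|a u IHu]; first by rewrite big_nil.
by rewrite big_cons IHu -cat1s pclass_cat.
Qed.

Lemma pgen_presents (A : Type) (R : seq A -> seq A -> Prop) :
  presents R (pgen R).
Proof.
split=> [x|u w]; first by exists (prepr x); rewrite word_val_pgen preprK.
by rewrite !word_val_pgen pclassP.
Qed.

(* All indices below are 0-based: i : 'I_n.-1 stands for the usual index      *)
(* i + 1 in {1, ..., n - 1}, and k : 'I_n for k + 1 in {1, ..., n}.           *)

Inductive stvb_gen (n : nat) : Type :=
  | Sig of 'I_n.-1
  | SigV of 'I_n.-1
  | Vir of 'I_n.-1
  | Tau of 'I_n.-1
  | Gam of 'I_n.

Definition far (i j : nat) : bool := (i.+1 < j) || (j.+1 < i).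

Inductive stvb_rel (n : nat) : seq (stvb_gen n) -> seq (stvb_gen n) -> Prop :=
  | SigSigV i : stvb_rel [:: Sig i; SigV i] [::]
  | SigVSig i : stvb_rel [:: SigV i; Sig i] [::]
  | Vir_sq i : stvb_rel [:: Vir i; Vir i] [::]
  | Gam_sq k : stvb_rel [:: Gam k; Gam k] [::]
  | SigSig_far (i j : 'I_n.-1) : far i j ->
      stvb_rel [:: Sig i; Sig j] [:: Sig j; Sig i]
  | VirVir_far (i j : 'I_n.-1) : far i j ->
      stvb_rel [:: Vir i; Vir j] [:: Vir j; Vir i]
  | TauTau_far (i j : 'I_n.-1) : far i j ->
      stvb_rel [:: Tau i; Tau j] [:: Tau j; Tau i]
  | SigVir_far (i j : 'I_n.-1) : far i j ->
      stvb_rel [:: Sig i; Vir j] [:: Vir j; Sig i]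
  | SigTau_far (i j : 'I_n.-1) : far i j ->
      stvb_rel [:: Sig i; Tau j] [:: Tau j; Sig i]
  | TauVir_far (i j : 'I_n.-1) : far i j ->
      stvb_rel [:: Tau i; Vir j] [:: Vir j; Tau i]
  | GamGam k l : stvb_rel [:: Gam k; Gam l] [:: Gam l; Gam k]
  | GamSig_far (k : 'I_n) (i : 'I_n.-1) :
      k <> i :> nat -> k <> i.+1 :> nat ->
      stvb_rel [:: Gam k; Sig i] [:: Sig i; Gam k]
  | GamVir_far (k : 'I_n) (i : 'I_n.-1) :
      k <> i :> nat -> k <> i.+1 :> nat ->
      stvb_rel [:: Gam k; Vir i] [:: Vir i; Gam k]
  | GamTau_far (k : 'I_n) (i : 'I_n.-1) :
      k <> i :> nat -> k <> i.+1 :> nat ->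
      stvb_rel [:: Gam k; Tau i] [:: Tau i; Gam k]
  | SigSigSig (i j : 'I_n.-1) : j = i.+1 :> nat ->
      stvb_rel [:: Sig i; Sig j; Sig i] [:: Sig j; Sig i; Sig j]
  | VirVirVir (i j : 'I_n.-1) : j = i.+1 :> nat ->
      stvb_rel [:: Vir i; Vir j; Vir i] [:: Vir j; Vir i; Vir j]
  | VirSigVir (i j : 'I_n.-1) : j = i.+1 :> nat ->
      stvb_rel [:: Vir i; Sig j; Vir i] [:: Vir j; Sig i; Vir j]
  | VirTauVir (i j : 'I_n.-1) : j = i.+1 :> nat ->
      stvb_rel [:: Vir i; Tau j; Vir i] [:: Vir j; Tau i; Vir j]
  | SigTau i : stvb_rel [:: Sig i; Tau i] [:: Tau i; Sig i]
  | SigSigTau (i j : 'I_n.-1) : j = i.+1 :> nat ->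
      stvb_rel [:: Sig i; Sig j; Tau i] [:: Tau j; Sig i; Sig j]
  | GamVir (i : 'I_n.-1) (k l : 'I_n) : k = i :> nat -> l = i.+1 :> nat ->
      stvb_rel [:: Gam l; Vir i] [:: Vir i; Gam k]
  | GamSigGam (i : 'I_n.-1) (k l : 'I_n) : k = i :> nat -> l = i.+1 :> nat ->
      stvb_rel [:: Vir i; Sig i; Vir i]
               [:: Gam l; Gam k; Sig i; Gam k; Gam l]
  | GamTauGam (i : 'I_n.-1) (k l : 'I_n) : k = i :> nat -> l = i.+1 :> nat ->
      stvb_rel [:: Vir i; Tau i; Vir i]
               [:: Gam l; Gam k; Tau i; Gam k; Gam l].

Definition STVB (n : nat) : monoidType := pmonoid (@stvb_rel n).

Definition stvb_elt (n : nat) : stvb_gen n -> STVB n := pgen (@stvb_rel n).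

(* The reduced alphabet sigma_1, sigma_1^-1, tau_1, gamma_1, v_1 ... v_(n-1). *)
Inductive red_gen (n : nat) : Type :=
  | rSig
  | rSigV
  | rTau
  | rGam
  | rVir of 'I_n.-1.

Arguments rSig {n}.
Arguments rSigV {n}.
Arguments rTau {n}.
Arguments rGam {n}.

(* In red_rel the hypotheses v_at 1 i1, v_at 2 i2, v_at 3 i3 say that rVir i1,*)
(* rVir i2, rVir i3 are the letters v_1, v_2, v_3; relations that mention a   *)
(* letter v_p with p >= n are thereby excluded.                               *)
Definition v_at (n p : nat) (i : 'I_n.-1) : Prop := i.+1 = p.

Definition conj12 (n : nat) (i1 i2 : 'I_n.-1) (x : red_gen n) :
    seq (red_gen n) :=
  [:: rVir i1; rVir i2; x; rVir i2; rVir i1].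

Definition conj2312 (n : nat) (i1 i2 i3 : 'I_n.-1) (x : red_gen n) :
    seq (red_gen n) :=
  [:: rVir i2; rVir i3; rVir i1; rVir i2; x;
      rVir i2; rVir i1; rVir i3; rVir i2].

Inductive red_rel (n : nat) : seq (red_gen n) -> seq (red_gen n) -> Prop :=
  | rVir_sq i : red_rel [:: rVir i; rVir i] [::]
  | rVirVir_far (i j : 'I_n.-1) : far i j ->
      red_rel [:: rVir i; rVir j] [:: rVir j; rVir i]
  | rVirVirVir (i j : 'I_n.-1) : j = i.+1 :> nat ->
      red_rel [:: rVir i; rVir j; rVir i] [:: rVir j; rVir i; rVir j]
  | rSigSig_far i1 i2 i3 : v_at 1 i1 -> v_at 2 i2 -> v_at 3 i3 ->
      red_rel (rSig :: conj2312 i1 i2 i3 rSig)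
              (rcons (conj2312 i1 i2 i3 rSig) rSig)
  | rSigSigSig i1 i2 : v_at 1 i1 -> v_at 2 i2 ->
      red_rel
        [:: rVir i1; rSig; rVir i1; rVir i2; rSig; rVir i2;
            rVir i1; rSig; rVir i1]
        [:: rVir i2; rSig; rVir i2; rVir i1; rSig; rVir i1;
            rVir i2; rSig; rVir i2]
  | rSigVir_far (j : 'I_n.-1) : 3 <= j.+1 ->
      red_rel [:: rSig; rVir j] [:: rVir j; rSig]
  | rGam_sq : red_rel [:: rGam; rGam] [::]
  | rGamVir_far (j : 'I_n.-1) : 2 <= j.+1 ->
      red_rel [:: rGam; rVir j] [:: rVir j; rGam]
  | rGamGam i1 : v_at 1 i1 ->
      red_rel [:: rGam; rVir i1; rGam; rVir i1]
              [:: rVir i1; rGam; rVir i1; rGam]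
  | rGamSig_far i1 i2 : v_at 1 i1 -> v_at 2 i2 ->
      red_rel (rGam :: conj12 i1 i2 rSig) (rcons (conj12 i1 i2 rSig) rGam)
  | rGamSigGam i1 : v_at 1 i1 ->
      red_rel [:: rGam; rVir i1; rGam; rSig; rGam; rVir i1; rGam] [:: rSig]
  | rSigSigV : red_rel [:: rSig; rSigV] [::]
  | rSigVSig : red_rel [:: rSigV; rSig] [::]
  | rSigTau : red_rel [:: rSig; rTau] [:: rTau; rSig]
  | rTauVir_far (i : 'I_n.-1) : 3 <= i.+1 ->
      red_rel [:: rTau; rVir i] [:: rVir i; rTau]
  | rTauSigSig i1 i2 : v_at 1 i1 -> v_at 2 i2 ->
      red_rel (rTau :: conj12 i1 i2 rSig ++ [:: rSig])
              (conj12 i1 i2 rSig ++ rSig :: conj12 i1 i2 rTau)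
  | rTauSig_far i1 i2 i3 : v_at 1 i1 -> v_at 2 i2 -> v_at 3 i3 ->
      red_rel (rTau :: conj2312 i1 i2 i3 rSig)
              (rcons (conj2312 i1 i2 i3 rSig) rTau)
  | rTauTau_far i1 i2 i3 : v_at 1 i1 -> v_at 2 i2 -> v_at 3 i3 ->
      red_rel (rTau :: conj2312 i1 i2 i3 rTau)
              (rcons (conj2312 i1 i2 i3 rTau) rTau)
  | rGamTau_far i1 i2 : v_at 1 i1 -> v_at 2 i2 ->
      red_rel (rGam :: conj12 i1 i2 rTau) (rcons (conj12 i1 i2 rTau) rGam)
  | rGamTauGam i1 : v_at 1 i1 ->
      red_rel [:: rGam; rVir i1; rGam; rTau; rGam; rVir i1; rGam] [:: rTau].

Fact first_index_subproof (n : nat) : 2 <= n -> 0 < n.-1.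
Proof. by case: n => [|[|n]]. Qed.

Definition first_index (n : nat) (hn : 2 <= n) : 'I_n.-1 :=
  Ordinal (first_index_subproof hn).

Definition first_strand (n : nat) (hn : 2 <= n) : 'I_n := Ordinal (ltnW hn).

Definition red_letter (n : nat) (hn : 2 <= n) (a : red_gen n) : stvb_gen n :=
  match a with
  | rSig => Sig (first_index hn)
  | rSigV => SigV (first_index hn)
  | rTau => Tau (first_index hn)
  | rGam => Gam (first_strand hn)
  | rVir i => Vir i
  end.

(* Main.v *)
(* Everything is expressed through the conjugations cj a x = a x a by         *)
(* involutions a.  In the reduced monoid put x_{i+1} = v_i v_{i+1} x_i        *)
(* v_{i+1} v_i for x = sigma, tau, and gamma_{k+1} = v_k gamma_k v_k.         *)
(* Conjugation by products of v's shifts indices, so each relation of STVB_n  *)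
(* only has to be checked at the smallest indices, where it is a reduced      *)
(* relation up to conjugation.  Two reduced relations come out mirrored:      *)
(* tau_1 sigma_2 sigma_1 = sigma_2 sigma_1 tau_2, recovered by the            *)
(* conjugation [reverse3], and tau_1 sigma_3 = sigma_3 tau_1, recovered by    *)
(* conjugation with v_2 v_3 v_1 v_2.                                          *)

Require Import Defs.
From mathcomp Require Import all_boot.
From mathcomp Require Import zify.

Set Implicit Arguments.
Unset Strict Implicit.
Unset Printing Implicit Defensive.

Local Open Scope group_scope.

(** This is a Tietze reduction ([presents_sub_alphabet]). It suffices that the reduced letters, read
    in $STVB_n$, satisfy the reduced relations ([stvb_red_rel]) and generate ([stvb_red_onto]), and
    that [stvb_to_red] sends the full generators to elements of the reduced monoid that satisfy
    every relation of $STVB_n$, fixing the reduced letters. The resulting morphism is a left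
    inverse, so the reduced letters satisfy no further relations in $STVB_n$.

    Both verifications use one abstract setting: [virtual] records the relations among the $v_i$,
    [strands] those of the $\gamma_k$ with each other and with the $v_i$, and [crossing] those that
    $\sigma$ and $\tau$ obey alike. In $STVB_n$ the given generators form such families. In the
    reduced monoid the families are built by conjugating $\gamma_1,\sigma_1,\tau_1$ by $v$'s, and
    [strands_str_fam] and [crossing_cr_fam] derive all their properties from conditions at the
    smallest indices, which are reduced relations.

    The relations between two crossings, or three, are then carried from the smallest indices to all
    others by conjugation ([crossing_far], [crossing_braid], [crossing_slide], [crossing_comm]). The
    two mirrored relations are handled by [crossing_slide_rev] and [crossing_far_sym]. *)

(** * Conjugation by involutions *)

Section Conjugation.
Variable M : monoidType.
Implicit Types a b c x y z : M.

Definition cj a x := a * x * a.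

Lemma cjM a x y : a * a = 1 -> cj a (x * y) = cj a x * cj a y.
Proof. by move=> a2; rewrite /cj -!mulgA (mulgA a a) a2 mul1g. Qed.

Lemma cjK a x : a * a = 1 -> cj a (cj a x) = x.
Proof. by move=> a2; rewrite /cj -!mulgA a2 mulg1 mulgA a2 mul1g. Qed.

Lemma cj_inj a x y : a * a = 1 -> cj a x = cj a y -> x = y.
Proof. by move=> a2 /(congr1 (cj a)); rewrite !cjK. Qed.

Lemma cj_fixP a x : a * a = 1 -> cj a x = x <-> a * x = x * a.
Proof.
move=> a2; rewrite /cj; split=> [{2}<-|->]; first by rewrite -!mulgA a2 mulg1.
by rewrite -mulgA a2 mulg1.
Qed.

Lemma cj_swapP a x y : a * a = 1 -> cj a x = y <-> y * a = a * x.
Proof.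
move=> a2; rewrite /cj; split=> [<-|h]; first by rewrite -mulgA a2 mulg1.
by rewrite -h -mulgA a2 mulg1.
Qed.

Lemma cj_cj a b x : cj (cj a b) x = cj a (cj b (cj a x)).
Proof. by rewrite /cj !mulgA. Qed.

Lemma cjC a b x : a * b = b * a -> cj a (cj b x) = cj b (cj a x).
Proof. by move=> ab; rewrite /cj !mulgA ab -!mulgA ab. Qed.

Lemma cj_braid a b x : a * b * a = b * a * b ->
  cj a (cj b (cj a x)) = cj b (cj a (cj b x)).
Proof.
have e c d y : cj c (cj d (cj c y)) = cj (c * d * c) y by rewrite /cj !mulgA.
by move=> h; rewrite !e h.
Qed.

Lemma cj_comm a x y : a * a = 1 -> x * y = y * x ->
  cj a x * cj a y = cj a y * cj a x.
Proof. by move=> a2 xy; rewrite -!cjM ?xy. Qed.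

(** With $a=v_1$, $x=\sigma_1$, $y=v_2\sigma_1v_2$, so that [cj a y] is $\sigma_2$, this links the
    braid relation to its reduced form; each is the other conjugated by $v_1$. *)
Lemma cj_braid_rel a x y : a * a = 1 ->
  x * cj a y * x = cj a y * x * cj a y <-> cj a x * y * cj a x = y * cj a x * y.
Proof.
move=> a2; have e : cj a (x * cj a y * x) = cj a x * y * cj a x.
  by rewrite (cjM (x * _)) // (cjM x) // cjK.
have e' : cj a (cj a y * x * cj a y) = y * cj a x * y.
  by rewrite (cjM (_ * x)) // (cjM _ x) // cjK.
by rewrite -e -e'; split=> [->|/(cj_inj a2)].
Qed.

End Conjugation.

(** * Families of strands and crossings generated from their first member *)

Section Families.
Variables (M : monoidType) (N : nat) (v : nat -> M).

(* Indices are 0-based: v i and x i make sense for i < N, and g k for k <= N, *)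
(* where N = n - 1; values outside these ranges are junk.                     *)
Record virtual : Prop := Virtual {
  vir_sq i : i < N -> v i * v i = 1;
  vir_far i j : i.+1 < j -> j < N -> v i * v j = v j * v i;
  vir_braid i : i.+1 < N -> v i * v i.+1 * v i = v i.+1 * v i * v i.+1 }.

Record strands (g : nat -> M) : Prop := Strands {
  str_sq k : k <= N -> g k * g k = 1;
  str_comm k l : k <= N -> l <= N -> g k * g l = g l * g k;
  str_step i : i < N -> cj (v i) (g i) = g i.+1;
  str_far i k : i < N -> k <= N -> k <> i -> k <> i.+1 -> cj (v i) (g k) =
    g k }.

Record crossing (g x : nat -> M) : Prop := Crossing {
  cr_step i : i.+1 < N -> x i.+1 = cj (v i) (cj (v i.+1) (x i));
  cr_far i j : i < N -> j < N -> far i j -> cj (v j) (x i) = x i;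
  cr_gam k i : k <= N -> i < N -> k <> i -> k <> i.+1 -> cj (g k) (x i) = x i;
  cr_flip i : i < N -> cj (v i) (x i) = cj (g i.+1) (cj (g i) (x i)) }.

(** Raising the index one step at a time conjugates by $v_iv_{i+1}$; commuting distant $v$'s turns
    the accumulated conjugator into the closed form $(v_{i-1}\cdots v_1)(v_i\cdots v_2)$. *)
Fixpoint cr_fam (x : M) (i : nat) : M :=
  if i is j.+1 then cj (v j) (cj (v j.+1) (cr_fam x j)) else x.

Fixpoint str_fam (g : M) (k : nat) : M :=
  if k is j.+1 then cj (v j) (str_fam g j) else g.

Hypothesis vP : virtual.

Lemma vir_cjC i j x : i < N -> j < N -> far i j ->
  cj (v i) (cj (v j) x) = cj (v j) (cj (v i) x).
Proof.
by move=> iN jN /orP[ij|ji]; last symmetry; apply/cjC/(vir_far vP).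
Qed.

Lemma vir_cj_braid i x : i.+1 < N ->
  cj (v i) (cj (v i.+1) (cj (v i) x)) =
  cj (v i.+1) (cj (v i) (cj (v i.+1) x)).
Proof. by move=> iN; apply/cj_braid/(vir_braid vP). Qed.

Lemma cr_fam_far x : (forall j, 1 < j < N -> cj (v j) x = x) ->
  forall i j, i < N -> j < N -> far i j -> cj (v j) (cr_fam x i) = cr_fam x i.
Proof.
move=> xP; elim/ltn_ind => -[|i] IH j iN jN fij; first by rewrite xP //;
  move: fij; rewrite /far; lia.
have [ij|ji] : i.+2 < j \/ j < i by move: fij; rewrite /far; lia.
  rewrite /= (vir_cjC (i := j) (j := i)); try by rewrite /far; lia.
  rewrite (vir_cjC (i := j) (j := i.+1)); try by rewrite /far; lia.
  by rewrite IH // /far; lia.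
have [ji'|eji] : j.+1 < i \/ i = j.+1 by lia.
  rewrite /= (vir_cjC (i := j) (j := i)); try by rewrite /far; lia.
  rewrite (vir_cjC (i := j) (j := i.+1)); try by rewrite /far; lia.
  by rewrite IH // /far; lia.
(* The crossing is now $x_{j+2}$, unfolded down to $x_j$. One commutation and two braid moves carry
   $v_j$ through the conjugator $v_{j+1}v_{j+2}v_jv_{j+1}$; it comes out as $v_{j+2}$, which fixes
   $x_j$. *)
subst i; rewrite /= (vir_cjC (i := j.+2) (j := j)); try by rewrite /far; lia.
rewrite vir_cj_braid; last lia.
rewrite (vir_cj_braid (i := j.+1)) // IH //; rewrite /far; lia.
Qed.

Lemma str_fam_far g : (forall j, 0 < j < N -> cj (v j) g = g) ->
  forall i k, i < N -> k <= N -> k <> i -> k <> i.+1 ->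
  cj (v i) (str_fam g k) = str_fam g k.
Proof.
move=> gP i k; elim/ltn_ind: k i => -[|k] IH i iN kN ki ki';
  first by rewrite gP //; lia.
have [f|e] : far i k \/ k = i.+1 by rewrite /far; lia.
  rewrite /= (vir_cjC (i := i) (j := k)) // ?(IH k _ i) //; move: f;
    rewrite /far; lia.
by subst k; rewrite /= vir_cj_braid // (IH i) //; lia.
Qed.

(** Commutation spreads from the pair of indices $(0,1)$: conjugating by later $v$'s, which fix [g],
    raises the larger index, and then conjugation raises the smaller one. *)
Lemma strands_str_fam g : 0 < N -> g * g = 1 ->
  (forall j, 0 < j < N -> cj (v j) g = g) ->
  g * cj (v 0) g = cj (v 0) g * g -> strands (str_fam g).
Proof.
move=> N0 g2 gP gg; have farP := str_fam_far gP.
have comm0 k : k < N -> g * str_fam g k.+1 = str_fam g k.+1 * g.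
  elim: k => [//|k IH] kN; have := IH (ltnW kN).
  move/(cj_comm (vir_sq vP kN)).
  by rewrite gP //; apply.
have comm k l : k < l -> l <= N ->
    str_fam g k * str_fam g l = str_fam g l * str_fam g k.
  elim: k l => [[//|l]|k IH l] kl lN; first exact: comm0.
  have kN : k < N by lia.
  have := cj_comm (vir_sq vP kN) (IH l (ltnW kl) lN).
  by rewrite (farP k l) //; lia.
split=> // [k|k l kN lN].
  elim: k => [//|k IH] kN; have k2 := vir_sq vP kN.
  by rewrite /= -cjM // IH ?(ltnW kN) // /cj mulg1.
by case: (ltngtP k l) => [kl|lk|-> //]; [|symmetry]; apply: comm.
Qed.

Variable g : nat -> M.
Hypothesis gP : strands g.

(** The $\gamma$'s are pushed through the conjugators by [gstep] ($\gamma_{k+1}v_k=v_k\gamma_k$) and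
    [gfix], which reduces every case to the three conditions on [x]. *)
Lemma crossing_cr_fam x : 0 < N ->
  (forall j, 1 < j < N -> cj (v j) x = x) ->
  (1 < N -> cj (g 0) (cr_fam x 1) = cr_fam x 1) ->
  cj (g 0) (cj (v 0) (cj (g 0) x)) = x -> crossing g (cr_fam x).
Proof.
move=> N0 xP x1 x0; have farP := cr_fam_far xP.
have gfar1 i : i.+1 < N -> cj (g 0) (cr_fam x i.+1) = cr_fam x i.+1.
  elim: i => [//|i IH] iN.
  have gC j z : 0 < j < N -> cj (g 0) (cj (v j) z) = cj (v j) (cj (g 0) z).
    move=> jN; apply: cjC; symmetry; apply/cj_fixP;
      first by apply: (vir_sq vP); lia.
    by apply: (str_far gP) => //; lia.
  have -> : cr_fam x i.+2 = cj (v i.+1) (cj (v i.+2) (cr_fam x i.+1)) by [].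
  by rewrite (gC i.+1) ?(ltnW iN) // (gC i.+2) // IH // ltnW.
have gstep k z : k < N -> cj (g k.+1) (cj (v k) z) = cj (v k) (cj (g k) z).
  move=> kN; rewrite -(str_step gP kN) cj_cj ?cjK //; exact: (vir_sq vP).
have gfix k i z : i < N -> k <= N -> k <> i -> k <> i.+1 ->
    cj (g k) (cj (v i) z) = cj (v i) (cj (g k) z).
  move=> iN kN ki ki'; apply: cjC; symmetry; apply/cj_fixP;
    first exact: (vir_sq vP).
  exact: (str_far gP).
have gfar_lt k i : k < i -> i < N -> cj (g k) (cr_fam x i) = cr_fam x i.
  elim: k => [|k IH] ki iN; first by case: i ki iN => // i _; apply: gfar1.
  have kN : k < N by lia.
  have fk : cj (v k) (cr_fam x i) = cr_fam x i by apply: farP => //;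
    rewrite /far; lia.
  by rewrite -{1}fk gstep ?IH //; lia.
have gfar_gt k i : i.+1 < k -> k <= N -> cj (g k) (cr_fam x i) = cr_fam x i.
  elim: k => // k IH ik kN.
  (* For the strand just above the crossing, $x_i$ is rewritten as a conjugate of $x_{i+1}$; pushing
     $\gamma_{i+2}$ inwards lowers it to $\gamma_i$, which lies below $x_{i+1}$ and is covered by
     [gfar_lt]. *)
  have [e|ik'] : k = i.+1 \/ i.+1 < k by lia.
    subst k; have i2 := vir_sq vP kN; have i2' := vir_sq vP (ltnW kN).
    have -> : cr_fam x i = cj (v i.+1) (cj (v i) (cr_fam x i.+1))
      by rewrite /= !cjK.
    by rewrite !gstep ?gfar_lt ?(ltnW kN).
  have fk : cj (v k) (cr_fam x i) = cr_fam x i by apply: farP => //;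
    rewrite /far; lia.
  by rewrite -{1}fk gstep ?IH //; lia.
split=> // [k i kN iN ki ki'|].
  have [lt|gt] : k < i \/ i.+1 < k by lia.
    exact: gfar_lt.
  exact: gfar_gt.
elim=> [|i IH] iN.
  by rewrite -(str_step gP iN) cj_cj ?(vir_sq vP) //= x0.
rewrite /= -vir_cj_braid // IH; last lia.
by rewrite (gstep i) ?(gfix i.+2 i) ?(gfix i i.+1) ?(gstep i.+1) //; lia.
Qed.

End Families.

(** * Carrying relations between crossings to all indices *)

Section Crossings.
Variables (M : monoidType) (N : nat) (v g : nat -> M).
Hypotheses (vP : virtual N v) (gP : strands N v g).

(** Together with [crossing_shift_next]: a single conjugation, by $v_iv_{i+1}v_{i+2}$, moves the
    adjacent pair $(x_i,x_{i+1})$ to $(x_{i+1},x_{i+2})$, so relations in such a pair propagate. *)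
Lemma crossing_shift x i : crossing N v g x -> i.+2 < N ->
  cj (v i) (cj (v i.+1) (cj (v i.+2) (x i))) = x i.+1.
Proof.
move=> xP iN; rewrite (cr_far xP) ?(cr_step xP) //; try lia.
by rewrite /far; lia.
Qed.

Lemma crossing_shift_next x i : crossing N v g x -> i.+2 < N ->
  cj (v i) (cj (v i.+1) (cj (v i.+2) (x i.+1))) = x i.+2.
Proof.
move=> xP iN; rewrite -(cr_step xP) // (cr_far xP) //; try lia.
by rewrite /far; lia.
Qed.

(* Conjugation by gamma_1 gamma_2 gamma_3 (v_1 v_2 v_1) exchanges x_1 and x_2:*)
(* by [cr_flip] the gammas undo the flip of the crossing that reversing its   *)
(* two strands produces.                                                      *)
Definition reverse3 z :=
  cj (g 0) (cj (g 1%N) (cj (g 2) (cj (v 0) (cj (v 1%N) (cj (v 0) z))))).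

Lemma reverse3M y z : 1 < N -> reverse3 (y * z) = reverse3 y * reverse3 z.
Proof.
move=> N1; rewrite /reverse3 !cjM //; try (apply: (vir_sq vP); lia).
all: by apply: (str_sq gP); lia.
Qed.

Lemma reverse3_crossing x : crossing N v g x -> 1 < N ->
  reverse3 (x 0) = x 1%N /\ reverse3 (x 1%N) = x 0.
Proof.
move=> xP N1; have N0 := ltnW N1.
have gC k l z : k <= N -> l <= N -> cj (g k) (cj (g l) z) =
  cj (g l) (cj (g k) z).
  by move=> kN lN; apply/cjC/(str_comm gP).
rewrite /reverse3; split.
  rewrite (vir_cj_braid vP) // -(cr_step xP) // (cr_flip xP) //.
  by rewrite (cjK _ (str_sq gP _)) // (cjK _ (str_sq gP _)) // (cr_gam xP).
rewrite {1}(cr_step xP) // !(cjK _ (vir_sq vP _)) // (cr_flip xP) //.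
rewrite (gC 2%N 1%N) // (cjK _ (str_sq gP _)) // (gC 2%N 0%N) //
  (cjK _ (str_sq gP _)) //.
by rewrite (cr_gam xP).
Qed.

Lemma crossing_far x y : crossing N v g x -> crossing N v g y ->
  (2 < N -> x 0 * y 2 = y 2 * x 0) ->
  forall i j, i.+1 < j -> j < N -> x i * y j = y j * x i.
Proof.
move=> xP yP xy; have v2 := vir_sq vP.
elim=> [|i IH] j ij jN.
  elim: j => // j IHj in ij jN *; have [e|ij'] : j = 1%N \/ 1 < j by lia.
    by subst j; apply: xy.
  have := cj_comm (v2 _ (ltnW jN)) (cj_comm (v2 _ jN) (IHj ij' (ltnW jN))).
  by rewrite -(cr_step yP) // !(cr_far xP) //; rewrite /far; lia.
have iN : i.+1 < N by lia.
have := cj_comm (v2 _ (ltnW iN)) (cj_comm (v2 _ iN) (IH j (ltnW ij) jN)).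
by rewrite -(cr_step xP) // !(cr_far yP) //; rewrite /far; lia.
Qed.

(** The conjugation [J] swaps the indices 0 and 2 in every crossing family; it is an involution
    because $v_0$ and $v_2$ commute. *)
Lemma crossing_far_sym x y : crossing N v g x -> crossing N v g y ->
  2 < N -> x 0 * y 2 = y 2 * x 0 -> y 0 * x 2 = x 2 * y 0.
Proof.
move=> xP yP N2 xy; pose J z := cj (v 1%N) (cj (v 2) (cj (v 0) (cj (v 1%N) z))).
have v2 i : i < 3 -> v i * v i = 1 by move=> i3; apply: (vir_sq vP); lia.
have J02 z : crossing N v g z -> J (z 0) = z 2 /\ J (z 2) = z 0.
  move=> zP; have e : z 2 = J (z 0)
    by rewrite (cr_step zP) // (cr_step zP) //; lia.
  split=> //; rewrite e /J (cjK _ (v2 1%N isT)) (vir_cjC vP (i := 0) (j := 2))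
    //.
    by rewrite !cjK ?v2.
  by lia.
have := cj_comm (v2 1%N isT) (cj_comm (v2 2%N isT)
  (cj_comm (v2 0%N isT) (cj_comm (v2 1%N isT) xy))).
by rewrite -!/(J _) (J02 x xP).1 (J02 y yP).2.
Qed.

Lemma crossing_braid x : crossing N v g x ->
  (1 < N -> x 0 * x 1%N * x 0 = x 1%N * x 0 * x 1%N) ->
  forall i, i.+1 < N -> x i * x i.+1 * x i = x i.+1 * x i * x i.+1.
Proof.
move=> xP x01; elim=> // i IH iN.
rewrite -(crossing_shift xP iN) -(crossing_shift_next xP iN).
rewrite -!cjM ?IH ?(vir_sq vP) //; lia.
Qed.

Lemma crossing_slide x y : crossing N v g x -> crossing N v g y ->
  (1 < N -> x 0 * x 1%N * y 0 = y 1%N * x 0 * x 1%N) ->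
  forall i, i.+1 < N -> x i * x i.+1 * y i = y i.+1 * x i * x i.+1.
Proof.
move=> xP yP xy01; elim=> // i IH iN.
rewrite -(crossing_shift xP iN) -(crossing_shift_next xP iN).
rewrite -(crossing_shift yP iN) -(crossing_shift_next yP iN).
rewrite -!cjM ?IH ?(vir_sq vP) //; lia.
Qed.

(** The left form is the relation of $STVB_n$ and the right one the reduced relation; [reverse3]
    exchanges them. *)
Lemma crossing_slide_rev x y : crossing N v g x -> crossing N v g y ->
  1 < N -> (x 0 * x 1%N * y 0 = y 1%N * x 0 * x 1%N <->
            x 1%N * x 0 * y 1%N = y 0 * x 1%N * x 0).
Proof.
move=> xP yP N1.
have [x0 x1] := reverse3_crossing xP N1;
  have [y0 y1] := reverse3_crossing yP N1.
by split=> /(congr1 reverse3); rewrite !reverse3M // x0 x1 y0 y1.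
Qed.

Lemma crossing_comm x y : crossing N v g x -> crossing N v g y ->
  x 0 * y 0 = y 0 * x 0 -> forall i, i < N -> x i * y i = y i * x i.
Proof.
move=> xP yP xy0; elim=> // i IH iN.
by rewrite (cr_step xP) // (cr_step yP) // -!cjM ?IH ?(vir_sq vP) //; lia.
Qed.

End Crossings.

Lemma cr_fam_inv (M : monoidType) N (v : nat -> M) x y : virtual N v ->
  x * y = 1 -> forall i, i < N -> cr_fam v x i * cr_fam v y i = 1.
Proof.
move=> vP xy; elim=> // i IH iN.
by rewrite /= -!cjM ?(vir_sq vP) ?IH /cj ?mulg1 ?(vir_sq vP) ?mulg1 ?(vir_sq
  vP) //; lia.
Qed.

(** * Evaluation of words, and presentations on a smaller alphabet *)

Section Words.
Variables (A : Type) (M : monoidType) (f : A -> M).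

Lemma word_val_nil : word_val f [::] = 1.
Proof. exact: big_nil. Qed.

Lemma word_val_cons a u : word_val f (a :: u) = f a * word_val f u.
Proof. exact: big_cons. Qed.

Lemma word_val_cat u w : word_val f (u ++ w) = word_val f u * word_val f w.
Proof. exact: big_cat. Qed.

Lemma moncong_word_val (R : seq A -> seq A -> Prop) :
  (forall u w, R u w -> word_val f u = word_val f w) ->
  forall u w, moncong R u w -> word_val f u = word_val f w.
Proof.
move=> Rf u w; elim=> {u w} // [u w t _ -> //|u u' w w' _ uu' _ ww'].
by rewrite !word_val_cat uu' ww'.
Qed.

Definition word_valE := (word_val_cons, word_val_nil, @mulg1 M).

End Words.

Lemma word_val_rel (A : Type) (R : seq A -> seq A -> Prop) u w :
  R u w -> word_val (pgen R) u = word_val (pgen R) w.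
Proof. by move=> uw; apply/(pgen_presents R).2/moncong_rel. Qed.

(** If two words over [A] agree in the monoid of [S], applying [phi] to their images under [r]
    returns their classes modulo [R], so they were already congruent. *)
Lemma presents_sub_alphabet (A B : Type) (R : seq A -> seq A -> Prop)
    (S : seq B -> seq B -> Prop) (r : A -> B) (phi : B -> pmonoid R) :
  let f := fun a => pgen S (r a) in
  (forall u w, R u w -> word_val f u = word_val f w) ->
  (forall b, exists u, word_val f u = pgen S b) ->
  (forall u w, S u w -> word_val phi u = word_val phi w) ->
  (forall a, phi (r a) = pgen R a) ->
  presents R f.
Proof.
move=> f Rf fS Sphi phir; split=> [x|u w]; last first.
  split; last exact: moncong_word_val.
  have val_map (M : monoidType) (h : B -> M) t :
      word_val h (map r t) = word_val (h \o r) t by rewrite /word_val big_map.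
  have phi_map t : word_val phi (map r t) = pclass R t.
    rewrite val_map -word_val_pgen /word_val; apply: eq_bigr => a _;
      exact: phir.
  rewrite -!(val_map _ (pgen S)) => /(pgen_presents S).2 /(moncong_word_val
    Sphi).
  by rewrite !phi_map => /pclassP.
have [t <-] := (pgen_presents S).1 x.
elim: t => [|b t [w w_t]]; first by exists [::]; rewrite !word_val_nil.
by have [u u_b] := fS b; exists (u ++ w);
  rewrite word_val_cat word_val_cons u_b w_t.
Qed.

Section OrdinalExtension.
Variables (M : monoidType) (m : nat) (f : 'I_m -> M).

(** Indexing by [nat] permits the inductions above; the default 1 is the junk value outside the
    range. *)
Definition ord_ext (k : nat) : M := oapp f 1 (insub k).

Lemma ord_extE k (km : k < m) : ord_ext k = f (Ordinal km).
Proof. by rewrite /ord_ext insubT. Qed.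

Lemma ord_ext_ord (i : 'I_m) : ord_ext i = f i.
Proof. by rewrite /ord_ext valK. Qed.

End OrdinalExtension.

(** * In $STVB_n$ the reduced relations hold and the reduced letters generate *)

Section STVB.
Variables (n : nat) (hn : 2 <= n).

Local Notation N := n.-1.
Local Notation elt X := (ord_ext (fun i => stvb_elt (X i))).
Local Notation vr := (elt (@Vir n)).
Local Notation ga := (elt (@Gam n)).

Let N0 : 0 < N. Proof. by lia. Qed.
Let gaN k : k <= N -> k < n. Proof. by lia. Qed.

Let rel u w (h : stvb_rel u w) : word_val (@stvb_elt n) u =
  word_val (@stvb_elt n) w :=
  word_val_rel h.

Lemma stvb_virtual : virtual N vr.
Proof.
split=> [i iN|i j ij jN|i jN].
- by have := rel (Vir_sq (Ordinal iN)); rewrite !word_valE !(ord_extE _ iN).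
- have iN : i < N by lia.
  have f : far (Ordinal iN) (Ordinal jN) by apply/orP; left.
  by have := rel (VirVir_far f);
    rewrite !word_valE !(ord_extE _ iN) !(ord_extE _ jN).
have iN := ltnW jN; have := rel (@VirVirVir _ (Ordinal iN) (Ordinal jN) erefl).
by rewrite !word_valE !mulgA !(ord_extE _ iN) !(ord_extE _ jN).
Qed.

Let vP := stvb_virtual.

Lemma stvb_strands : strands N vr ga.
Proof.
split=> [k /gaN kN|k l /gaN kN /gaN lN|i iN|i k iN /gaN kN ki ki'].
- by have := rel (Gam_sq (Ordinal kN)); rewrite !word_valE !(ord_extE _ kN).
- have := rel (GamGam (Ordinal kN) (Ordinal lN)).
  by rewrite !word_valE !(ord_extE _ kN) !(ord_extE _ lN).
- have [kN lN] := (gaN (ltnW iN), gaN iN).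
  apply/cj_swapP; first exact: vir_sq vP _ iN.
  have := rel (@GamVir _ (Ordinal iN) (Ordinal kN) (Ordinal lN) erefl erefl).
  by rewrite !word_valE (ord_extE _ iN) (ord_extE _ kN) (ord_extE _ lN).
apply/cj_fixP; first exact: vir_sq vP _ iN.
have := rel (@GamVir_far _ (Ordinal kN) (Ordinal iN) ki ki').
by rewrite !word_valE (ord_extE _ iN) (ord_extE _ kN) => ->.
Qed.

Let gP := stvb_strands.

Lemma stvb_crossing (X : 'I_N -> stvb_gen n) :
  (forall i j : 'I_N, j = i.+1 :> nat ->
    stvb_rel [:: Vir i; X j; Vir i] [:: Vir j; X i; Vir j]) ->
  (forall i j : 'I_N, far i j -> stvb_rel [:: X i; Vir j] [:: Vir j; X i]) ->
  (forall (k : 'I_n) (i : 'I_N), k <> i :> nat -> k <> i.+1 :> nat ->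
    stvb_rel [:: Gam k; X i] [:: X i; Gam k]) ->
  (forall (i : 'I_N) (k l : 'I_n), k = i :> nat -> l = i.+1 :> nat ->
    stvb_rel [:: Vir i; X i; Vir i] [:: Gam l; Gam k; X i; Gam k; Gam l]) ->
  crossing N vr ga (elt X).
Proof.
move=> XV Xfar Xgam Xflip.
split=> [i jN|i j iN jN f|k i /[dup] kN' /gaN kN iN ki ki'|i iN].
- have iN := ltnW jN; apply: (cj_inj (vir_sq vP iN)).
  rewrite (cjK _ (vir_sq vP iN)) /cj !(ord_extE _ iN) !(ord_extE _ jN).
  by have := rel (XV (Ordinal iN) (Ordinal jN) erefl);
    rewrite !word_valE !mulgA.
- apply/(cj_fixP _ (vir_sq vP jN)); rewrite !(ord_extE _ iN) !(ord_extE _ jN).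
  by have := rel (Xfar (Ordinal iN) (Ordinal jN) f); rewrite !word_valE.
- apply/(cj_fixP _ (str_sq gP kN')); rewrite !(ord_extE _ iN) !(ord_extE _ kN).
  by have := rel (Xgam (Ordinal kN) (Ordinal iN) ki ki'); rewrite !word_valE.
have [kN lN] := (gaN (ltnW iN), gaN iN).
rewrite /cj !(ord_extE _ iN) (ord_extE _ kN) (ord_extE _ lN).
have := rel (Xflip (Ordinal iN) (Ordinal kN) (Ordinal lN) erefl erefl).
by rewrite !word_valE !mulgA.
Qed.

Let sigP : crossing N vr ga (elt (@Sig n)).
Proof.
apply: stvb_crossing;
  [exact: VirSigVir|exact: SigVir_far|exact: GamSig_far|exact: GamSigGam].
Qed.

Let tauP : crossing N vr ga (elt (@Tau n)).
Proof.
apply: stvb_crossing;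
  [exact: VirTauVir|exact: TauVir_far|exact: GamTau_far|exact: GamTauGam].
Qed.

Let elt0 (X : 'I_N -> stvb_gen n) : stvb_elt (X (first_index hn)) = elt X 0.
Proof. by rewrite (ord_extE _ (first_index_subproof hn)). Qed.

Let vr_v_at p (i : 'I_N) : v_at p.+1 i -> stvb_elt (Vir i) = vr p.
Proof. by case=> <-; rewrite (ord_ext_ord (fun j => stvb_elt (Vir j))). Qed.

Let ga0 : stvb_elt (Gam (first_strand hn)) = ga 0.
Proof. by rewrite (ord_extE _ (ltnW hn)). Qed.

Let crossing2 x : crossing N vr ga x -> 2 < N ->
  x 2 = cj (vr 1%N) (cj (vr 2) (cj (vr 0) (cj (vr 1%N) (x 0)))).
Proof. by move=> xP N2; rewrite (cr_step xP) // (cr_step xP) // ltnW. Qed.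

Let v_at_lt p (i : 'I_N) : v_at p.+1 i -> p < N.
Proof. by case=> <-; apply: ltn_ord. Qed.

Let crossing1 x : crossing N vr ga x -> 1 < N -> x 1%N =
  cj (vr 0) (cj (vr 1%N) (x 0)).
Proof. by move=> xP; apply: (cr_step xP). Qed.

Let far02 (X Y : 'I_N -> stvb_gen n) :
  (forall i j : 'I_N, far i j -> stvb_rel [:: X i; Y j] [:: Y j; X i]) ->
  2 < N -> elt X 0 * elt Y 2 = elt Y 2 * elt X 0.
Proof.
move=> XY N2; rewrite (ord_extE _ N0) (ord_extE _ N2).
by have := rel (XY (Ordinal N0) (Ordinal N2) isT); rewrite !word_valE.
Qed.

Let braid01 : 1 < N -> elt (@Sig n) 0 * elt (@Sig n) 1%N * elt (@Sig n) 0 =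
  elt (@Sig n) 1%N * elt (@Sig n) 0 * elt (@Sig n) 1%N.
Proof.
move=> N1; rewrite !(ord_extE _ N0) !(ord_extE _ N1).
by have := rel (@SigSigSig n (Ordinal N0) (Ordinal N1) erefl);
  rewrite !word_valE !mulgA.
Qed.

Let slide01 : 1 < N -> elt (@Sig n) 0 * elt (@Sig n) 1%N * elt (@Tau n) 0 =
  elt (@Tau n) 1%N * elt (@Sig n) 0 * elt (@Sig n) 1%N.
Proof.
move=> N1; rewrite !(ord_extE _ N0) !(ord_extE _ N1).
by have := rel (@SigSigTau n (Ordinal N0) (Ordinal N1) erefl);
  rewrite !word_valE !mulgA.
Qed.

(** This is [cr_flip] at index 0 with $\gamma_2$ replaced by $v_1\gamma_1v_1$ and the outer $v_1$'s
    cancelled. *)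
Let gam_cross0 x : crossing N vr ga x ->
  ga 0 * vr 0 * ga 0 * x 0 * ga 0 * vr 0 * ga 0 = x 0.
Proof.
move=> xP; apply: (cj_inj (vir_sq vP N0)).
by rewrite (cr_flip xP) // -(str_step gP) // /cj !mulgA.
Qed.

Let gam_cross1 x : crossing N vr ga x -> 1 < N -> ga 0 * x 1%N = x 1%N * ga 0.
Proof.
by move=> xP N1; apply/(cj_fixP _ (str_sq gP (leq0n _))); rewrite (cr_gam xP).
Qed.

Lemma stvb_red_rel u w : red_rel u w ->
  word_val (fun a => stvb_elt (red_letter hn a)) u =
  word_val (fun a => stvb_elt (red_letter hn a)) w.
Proof.
case=> {u w} /=.
- by move=> i; have := rel (Vir_sq i); rewrite !word_valE.
- by move=> i j f; have := rel (VirVir_far f); rewrite !word_valE.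
- by move=> i j ij; have := rel (VirVirVir ij); rewrite !word_valE.
- move=> i1 i2 i3 a1 a2 a3; have N2 := v_at_lt a3;
    have := far02 (@SigSig_far n) N2.
  rewrite (crossing2 sigP N2) !word_valE /= !(elt0 (@Sig n)).
  by rewrite !(vr_v_at a1) !(vr_v_at a2) !(vr_v_at a3) /cj !mulgA.
- move=> i1 i2 a1 a2; have N1 := v_at_lt a2.
  have := braid01 N1;
    rewrite (crossing1 sigP N1) => /(cj_braid_rel _ _ (vir_sq vP N0)).
  rewrite !word_valE /=.
  by rewrite !(elt0 (@Sig n)) !(vr_v_at a1) !(vr_v_at a2) /cj !mulgA.
- move=> j j3; have f : far (first_index hn) j by apply/orP; left.
  by have := rel (SigVir_far f); rewrite !word_valE.
- by have := rel (Gam_sq (first_strand hn)); rewrite !word_valE.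
- move=> j j2; have := rel (@GamVir_far n (first_strand hn) j _ _).
  by rewrite !word_valE; apply=> /=; lia.
- move=> i1 a1; have := str_comm gP (leq0n N) N0.
  by rewrite -(str_step gP) // !word_valE /= ga0 !(vr_v_at a1) /cj !mulgA.
- move=> i1 i2 a1 a2; have := gam_cross1 sigP (v_at_lt a2).
  rewrite (crossing1 sigP (v_at_lt a2)) !word_valE /= ga0 !(elt0 (@Sig n)).
  by rewrite !(vr_v_at a1) !(vr_v_at a2) /cj !mulgA.
- move=> i1 a1; have := gam_cross0 sigP.
  by rewrite !word_valE /= ga0 !(elt0 (@Sig n)) !(vr_v_at a1) /cj !mulgA.
- by have := rel (SigSigV (first_index hn)); rewrite !word_valE.
- by have := rel (SigVSig (first_index hn)); rewrite !word_valE.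
- by have := rel (SigTau (first_index hn)); rewrite !word_valE.
- move=> j j3; have f : far (first_index hn) j by apply/orP; left.
  by have := rel (TauVir_far f); rewrite !word_valE.
- move=> i1 i2 a1 a2; have N1 := v_at_lt a2.
  have /esym := (crossing_slide_rev vP gP sigP tauP N1).1 (slide01 N1).
  rewrite (crossing1 sigP N1) (crossing1 tauP N1) !word_valE /=.
  by rewrite ?(elt0 (@Sig n)) ?(elt0 (@Tau n)) !(vr_v_at a1) !(vr_v_at a2) /cj
    !mulgA.
- move=> i1 i2 i3 a1 a2 a3; have N2 := v_at_lt a3.
  have := crossing_far_sym vP sigP tauP N2 (far02 (@SigTau_far n) N2).
  rewrite (crossing2 sigP N2) !word_valE /= !(elt0 (@Sig n)) !(elt0 (@Tau n)).
  by rewrite !(vr_v_at a1) !(vr_v_at a2) !(vr_v_at a3) /cj !mulgA.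
- move=> i1 i2 i3 a1 a2 a3; have N2 := v_at_lt a3;
    have := far02 (@TauTau_far n) N2.
  rewrite (crossing2 tauP N2) !word_valE /= !(elt0 (@Tau n)).
  by rewrite !(vr_v_at a1) !(vr_v_at a2) !(vr_v_at a3) /cj !mulgA.
- move=> i1 i2 a1 a2; have := gam_cross1 tauP (v_at_lt a2).
  rewrite (crossing1 tauP (v_at_lt a2)) !word_valE /= ga0 !(elt0 (@Tau n)).
  by rewrite !(vr_v_at a1) !(vr_v_at a2) /cj !mulgA.
- move=> i1 a1; have := gam_cross0 tauP.
  by rewrite !word_valE /= ga0 !(elt0 (@Tau n)) !(vr_v_at a1) /cj !mulgA.
Qed.

Lemma stvb_red_onto (b : stvb_gen n) : exists u : seq (red_gen n),
  word_val (fun a => stvb_elt (red_letter hn a)) u = stvb_elt b.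
Proof.
pose f := fun a => stvb_elt (red_letter hn a).
pose im x := exists u, word_val f u = x.
have im_cj i x : i < N -> im x -> im (cj (vr i) x).
  move=> iN [u <-]; exists (rVir (Ordinal iN) :: u ++ [:: rVir (Ordinal iN)]).
  by rewrite !word_val_cons word_val_cat !word_valE (ord_extE _ iN) /cj !mulgA.
have im_gen a : im (f a) by exists [:: a]; rewrite !word_valE.
have im_cross x : crossing N vr ga x -> im (x 0) -> forall i : 'I_N, im (x i).
  move=> xP x0 [i iN] /=; elim: i iN => // i IH iN.
  by rewrite (cr_step xP) //; apply/im_cj/im_cj/IH; lia.
case: b => [i|i|i|i|k].
- by rewrite -(ord_ext_ord (fun j => stvb_elt (Sig j))); apply/im_cross;
    rewrite -?elt0; [|apply: (im_gen rSig)].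
(* No relation of $STVB_n$ expresses $\sigma_j^{-1}$ through the $v$'s directly. The conjugate of
   $\sigma_1^{-1}$ is a right inverse of $\sigma_j$, hence equals its left inverse
   $\sigma_j^{-1}$. *)
- have sV j (jN : j < N) : cr_fam vr (stvb_elt (SigV (first_index hn))) j =
    elt (@SigV n) j.
    have inv1 : cr_fam vr (elt (@Sig n) 0) j * cr_fam vr (stvb_elt (SigV
      (first_index hn))) j = 1.
      apply: cr_fam_inv vP _ _ jN; rewrite -elt0.
      by have := rel (SigSigV (first_index hn)); rewrite !word_valE.
    have e : elt (@Sig n) j = cr_fam vr (elt (@Sig n) 0) j.
      by elim: j jN {inv1} => //= j IH jN;
        rewrite -IH ?(ltnW jN) // (cr_step sigP).
    rewrite -e in inv1.
    have inv2 : elt (@SigV n) j * elt (@Sig n) j = 1.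
      rewrite !(ord_extE _ jN).
      by have := rel (SigVSig (Ordinal jN)); rewrite !word_valE.
    by rewrite -[LHS]mul1g -inv2 -mulgA inv1 mulg1.
  rewrite -(ord_ext_ord (fun j => stvb_elt (SigV j))) -sV //.
  elim: (i : nat) (ltn_ord i) => [_|j IH jN]; first exact: (im_gen rSigV).
  by apply/im_cj/im_cj/IH; lia.
- exact: (im_gen (rVir i)).
- by rewrite -(ord_ext_ord (fun j => stvb_elt (Tau j))); apply/im_cross;
    rewrite -?elt0; [|apply: (im_gen rTau)].
rewrite -(ord_ext_ord (fun j => stvb_elt (Gam j))).
have : k <= N by have := ltn_ord k; lia.
elim: (k : nat) => [_|j IH jN]; first by rewrite -ga0; exact: (im_gen rGam).
by rewrite -(str_step gP) //; apply/im_cj/IH/ltnW.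
Qed.

End STVB.

(** * In the reduced monoid the conjugated families satisfy the relations of $STVB_n$ *)

Section ReducedMonoid.
Variables (n : nat) (hn : 2 <= n).

Local Notation N := n.-1.
Local Notation elt a := (pgen (@red_rel n) a).
Local Notation v := (ord_ext (fun i => elt (rVir i))).
Local Notation fam a := (cr_fam v (elt a)).
Local Notation ga := (str_fam v (elt rGam)).

Let N0 : 0 < N. Proof. by lia. Qed.

Let rel u w (h : red_rel u w) : word_val (pgen (@red_rel n)) u =
  word_val (pgen (@red_rel n)) w :=
  word_val_rel h.

Lemma red_virtual : virtual N v.
Proof.
split=> [i iN|i j ij jN|i jN].
- by have := rel (rVir_sq (Ordinal iN)); rewrite !word_valE !(ord_extE _ iN).
- have iN : i < N by lia.
  have f : far (Ordinal iN) (Ordinal jN) by apply/orP; left.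
  by have := rel (rVirVir_far f);
    rewrite !word_valE !(ord_extE _ iN) !(ord_extE _ jN).
have iN := ltnW jN; have := rel (@rVirVirVir _ (Ordinal iN) (Ordinal jN) erefl).
by rewrite !word_valE !mulgA !(ord_extE _ iN) !(ord_extE _ jN).
Qed.

Let vP := red_virtual.

Lemma red_strands : strands N v ga.
Proof.
apply: strands_str_fam vP _ N0 _ _ _.
- by have := rel (@rGam_sq n); rewrite !word_valE.
- move=> j /andP[j0 jN]; apply/(cj_fixP _ (vir_sq vP jN));
    rewrite (ord_extE _ jN).
  by have := rel (@rGamVir_far n (Ordinal jN) j0); rewrite !word_valE.
have := rel (@rGamGam n (Ordinal N0) erefl).
by rewrite !word_valE /cj !(ord_extE _ N0) !mulgA.
Qed.

Let gP := red_strands.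

Lemma red_crossing a :
  (forall j : 'I_N, 3 <= j.+1 -> red_rel [:: a; rVir j] [:: rVir j; a]) ->
  (forall i1 i2 : 'I_N, v_at 1 i1 -> v_at 2 i2 ->
    red_rel (rGam :: conj12 i1 i2 a) (rcons (conj12 i1 i2 a) rGam)) ->
  (forall i1 : 'I_N, v_at 1 i1 ->
    red_rel [:: rGam; rVir i1; rGam; a; rGam; rVir i1; rGam] [:: a]) ->
  crossing N v ga (fam a).
Proof.
move=> aV ag aflip; apply: (crossing_cr_fam vP gP N0) => [j /andP[j1 jN]|N1|].
- apply/(cj_fixP _ (vir_sq vP jN)); rewrite (ord_extE _ jN).
  by have := rel (aV (Ordinal jN) j1); rewrite !word_valE.
- apply/(cj_fixP _ (str_sq gP (leq0n _))).
  have := rel (ag (Ordinal N0) (Ordinal N1) erefl erefl).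
  by rewrite !word_valE /= /cj !(ord_extE _ N0) !(ord_extE _ N1) !mulgA.
have := rel (aflip (Ordinal N0) erefl).
by rewrite !word_valE /cj !(ord_extE _ N0) !mulgA.
Qed.

Let sigP : crossing N v ga (fam rSig).
Proof. by apply: red_crossing;
  [exact: rSigVir_far|exact: rGamSig_far|exact: rGamSigGam]. Qed.

Let tauP : crossing N v ga (fam rTau).
Proof. by apply: red_crossing;
  [exact: rTauVir_far|exact: rGamTau_far|exact: rGamTauGam]. Qed.

Let far02 a b :
  (forall i1 i2 i3 : 'I_N, v_at 1 i1 -> v_at 2 i2 -> v_at 3 i3 ->
    red_rel (a :: conj2312 i1 i2 i3 b) (rcons (conj2312 i1 i2 i3 b) a)) ->
  2 < N -> fam a 0 * fam b 2 = fam b 2 * fam a 0.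
Proof.
move=> ab N2; have N1 := ltnW N2.
have := rel (ab (Ordinal N0) (Ordinal N1) (Ordinal N2) erefl erefl erefl).
by rewrite !word_valE /= /cj !(ord_extE _ N0) !(ord_extE _ N1) !(ord_extE _
  N2) !mulgA.
Qed.

(** The single commutation of [a] at index 0 with [b] at index 2 serves both orders of [i] and [j],
    thanks to [crossing_far_sym]. *)
Let farP a b : crossing N v ga (fam a) -> crossing N v ga (fam b) ->
  (2 < N -> fam a 0 * fam b 2 = fam b 2 * fam a 0) ->
  forall i j : 'I_N, far i j -> fam a i * fam b j = fam b j * fam a i.
Proof.
move=> aP bP ab i j /orP[ij|ji]; first exact: (crossing_far vP aP bP).
symmetry; apply: (crossing_far vP bP aP) => // N2.
exact: (crossing_far_sym vP aP bP N2 (ab N2)).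
Qed.

Definition stvb_to_red (b : stvb_gen n) : pmonoid (@red_rel n) :=
  match b with
  | Sig i => fam rSig i
  | SigV i => fam rSigV i
  | Vir i => elt (rVir i)
  | Tau i => fam rTau i
  | Gam k => ga k
  end.

Lemma stvb_to_red_rel u w : stvb_rel u w ->
  word_val stvb_to_red u = word_val stvb_to_red w.
Proof.
have vE (i : 'I_N) : elt (rVir i) = v i
  by rewrite (ord_ext_ord (fun j => elt (rVir j))).
have kN (k : 'I_n) : k <= N by have := ltn_ord k; lia.
have braid : 1 < N -> fam rSig 0 * fam rSig 1 * fam rSig 0 =
    fam rSig 1 * fam rSig 0 * fam rSig 1.
  move=> N1; apply/(cj_braid_rel _ _ (vir_sq vP N0)).
  have := rel (@rSigSigSig n (Ordinal N0) (Ordinal N1) erefl erefl).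
  by rewrite !word_valE /= /cj !(ord_extE _ N0) !(ord_extE _ N1) !mulgA.
have slide : 1 < N -> fam rSig 0 * fam rSig 1 * fam rTau 0 =
    fam rTau 1 * fam rSig 0 * fam rSig 1.
  move=> N1; apply/(crossing_slide_rev vP gP sigP tauP N1).
  have := rel (@rTauSigSig n (Ordinal N0) (Ordinal N1) erefl erefl).
  by rewrite !word_valE /= /cj !(ord_extE _ N0) !(ord_extE _ N1) !mulgA.
case=> {u w}.
- move=> i; rewrite !word_valE; apply: (cr_fam_inv vP) => //.
  by have := rel (@rSigSigV n); rewrite !word_valE.
- move=> i; rewrite !word_valE; apply: (cr_fam_inv vP) => //.
  by have := rel (@rSigVSig n); rewrite !word_valE.
- by move=> i; rewrite !word_valE /= vE (vir_sq vP).
- by move=> k; rewrite !word_valE (str_sq gP).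
- move=> i j f; rewrite !word_valE; apply: farP => //; apply: far02.
  exact: rSigSig_far.
- by move=> i j f; have := rel (rVirVir_far f); rewrite !word_valE.
- move=> i j f; rewrite !word_valE; apply: farP => //; apply: far02.
  exact: rTauTau_far.
- move=> i j f; rewrite !word_valE /= vE; symmetry.
  by apply/(cj_fixP _ (vir_sq vP (ltn_ord j))); rewrite (cr_far sigP).
(* The reduced relation has $\tau_1$ as the low crossing and the shifted $\sigma$ as the high one,
   so the roles of $\sigma$ and $\tau$ are exchanged first. *)
- move=> i j f; rewrite !word_valE; symmetry; apply: farP => //; last first.
    by move: f; rewrite /far orbC.
  apply: far02; exact: rTauSig_far.
- move=> i j f; rewrite !word_valE /= vE; symmetry.
  by apply/(cj_fixP _ (vir_sq vP (ltn_ord j))); rewrite (cr_far tauP).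
- by move=> k l; rewrite !word_valE (str_comm gP).
- move=> k i ki ki'; rewrite !word_valE.
  by apply/(cj_fixP _ (str_sq gP (kN k))); rewrite (cr_gam sigP).
- move=> k i ki ki'; rewrite !word_valE /= vE; symmetry.
  by apply/(cj_fixP _ (vir_sq vP (ltn_ord i))); rewrite (str_far gP).
- move=> k i ki ki'; rewrite !word_valE.
  by apply/(cj_fixP _ (str_sq gP (kN k))); rewrite (cr_gam tauP).
- move=> i j ij; rewrite !word_valE /= ij [LHS]mulgA [RHS]mulgA.
  by apply: (crossing_braid vP sigP braid); rewrite -ij.
- by move=> i j ij; have := rel (rVirVirVir ij); rewrite !word_valE.
- move=> i j ij; have iN := ltn_ord i; have jN : i.+1 < N by rewrite -ij.
  rewrite !word_valE /= !vE ij [LHS]mulgA [RHS]mulgA -[LHS]/(cj (v i) (fam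
    rSig i.+1)).
  by rewrite (cr_step sigP) // (cjK _ (vir_sq vP iN)).
- move=> i j ij; have iN := ltn_ord i; have jN : i.+1 < N by rewrite -ij.
  rewrite !word_valE /= !vE ij [LHS]mulgA [RHS]mulgA -[LHS]/(cj (v i) (fam
    rTau i.+1)).
  by rewrite (cr_step tauP) // (cjK _ (vir_sq vP iN)).
- move=> i; rewrite !word_valE; apply: (crossing_comm vP sigP tauP) => //.
  by have := rel (@rSigTau n); rewrite !word_valE.
- move=> i j ij; rewrite !word_valE /= ij [LHS]mulgA [RHS]mulgA.
  by apply: (crossing_slide vP sigP tauP slide); rewrite -ij.
- move=> i k l ki li; rewrite !word_valE /= vE ki li.
  by apply/(cj_swapP _ _ (vir_sq vP (ltn_ord i))); rewrite (str_step gP).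
- move=> i k l ki li; rewrite !word_valE /= vE ki li.
  by have := cr_flip sigP (ltn_ord i); rewrite /cj !mulgA.
- move=> i k l ki li; rewrite !word_valE /= vE ki li.
  by have := cr_flip tauP (ltn_ord i); rewrite /cj !mulgA.
Qed.

Lemma stvb_to_red_letter a : stvb_to_red (red_letter hn a) = elt a.
Proof. by case: a. Qed.

End ReducedMonoid.

Theorem theorem4p1 (n : nat) (hn : 2 <= n) :
  presents (@red_rel n) (fun a : red_gen n => stvb_elt (red_letter hn a)).
Proof.
apply: presents_sub_alphabet (@stvb_red_rel n hn) (stvb_red_onto hn) _ _.
  exact: stvb_to_red_rel hn.
exact: stvb_to_red_letter.
Qed.
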